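(* Let $F\in C^3(\mathbb{R}^n\setminus\{0\})$ be a strongly convex norm on $\mathbb{R}^n$, let $\Omega\subset\mathbb{R}^n$ be an open bounded domain, $u\in C(\overline\Omega)\cap C^2(\Omega)$, and let $\Sigma_t=\{x:u(x)=t\}$ be a non-degenerate level set of $u$ (that is, $\nabla u\neq0$ on $\Sigma_t$). Let $k\in\{1,\dots,n\}$. Then the anisotropic $k$-th mean curvature $S_k(\kappa_F)$ of $\Sigma_t$ satisfies, at every point of $\Sigma_t$, \[ S_k(\kappa_F)=S_k\Big(\big(\textstyle\sum_lF_{il}u_{lj}\big)_{i,j}\Big)=\frac1{F^{k+1}}\sum_{i,j}S_{k+1}^{ij}[u]\,u_jF_i , \] where $F$, $F_i$, $F_{il}$ are evaluated at $\nabla u$.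
   Context: Strongly convex norm: $F$ is a norm on $\mathbb{R}^n$ such that $\nabla^2(\frac12F^2)$ is positive definite on $\mathbb{R}^n\setminus\{0\}$. Subscripts denote partial derivatives: $F_i=\partial F/\partial\xi_i$, $F_{ij}=\partial^2F/\partial\xi_i\partial\xi_j$, $u_i=\partial u/\partial x_i$, $u_{ij}=\partial^2u/\partial x_i\partial x_j$. For an $n\times n$ matrix $A$ (not necessarily symmetric), $S_k(A)=\frac1{k!}\sum\delta_{i_1\cdots i_k}^{j_1\cdots j_k}A_{i_1j_1}\cdots A_{i_kj_k}$ is the sum of its principal $k\times k$ minors ($\delta$ is the generalized Kronecker symbol), with $S_0=1$ and $S_{n+1}=0$; $S_k^{ij}(A)=\partial S_k(A)/\partial A_{ij}$. For a vector $\lambda$, $S_k(\lambda)$ is the $k$-th elementary symmetric function of its entries ($0$ if $k$ exceeds the number of entries). Anisotropic Hessian (where $\nabla u\ne0$): $(A_F)_{ij}[u]=\sum_l(\tfrac12F^2)_{il}(\nabla u)u_{lj}$, and $S_k^{ij}[u]=S_k^{ij}(A_F[u])$. Curvatures: for a hypersurface $M$ with unit Euclidean normal $\nu$ (here $\nu=\nabla u/|\nabla u|$ on $\Sigma_t$), the anisotropic normal is $\nu_F=\nabla F(\nu)$. The anisotropic principal curvatures $\kappa_F=(\kappa_1^F,\dots,\kappa_{n-1}^F)$ at $p\in M$ are the eigenvalues of $d\nu_F:T_pM\to T_{\nu_F(p)}\partial\mathcal W$, where $\mathcal W=\{x:F^o(x)<1\}$, $F^o(x)=\sup_{\xi\ne0}\langle\xi,x\rangle/F(\xi)$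 (both tangent spaces equal $\nu(p)^\perp$). The anisotropic $k$-th mean curvature is $S_k(\kappa_F)$. *)

(* Defs.v *)
From HB Require Import structures.
From mathcomp Require Export all_boot all_order all_algebra.
From mathcomp Require Export all_classical all_reals all_analysis.

Set Implicit Arguments.
Unset Strict Implicit.
Unset Printing Implicit Defensive.

Import Order.TTheory GRing.Theory Num.Theory.
Import numFieldNormedType.Exports.

Local Open Scope classical_set_scope.
Local Open Scope ring_scope.

Section Calculus.
Variables (R : realType) (n : nat).
Implicit Types (f : 'rV[R]_n -> R) (x : 'rV[R]_n) (i j : 'I_n).

Definition partial i f x : R := 'D_(delta_mx 0 i) f x.

Definition grad f x : 'rV[R]_n := \row_i partial i f x.

Definition hess f x : 'M[R]_n := \matrix_(i, j) partial i (partial j f) x.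

(* [D] is meant to be open. *)
Fixpoint Ck_on (k : nat) (D : set 'rV[R]_n) f : Prop :=
  (forall x, D x -> {for x, continuous f}) /\
  match k with
  | 0 => True
  | k'.+1 => forall i,
      (forall x, D x -> derivable f x (delta_mx 0 i)) /\
      Ck_on k' D (partial i f)
  end.

Definition dotv (v w : 'rV[R]_n) : R := \sum_i v 0 i * w 0 i.

(* The library norm of ['rV[R]_n] is the sup norm, hence this definition. *)
Definition enorm (v : 'rV[R]_n) : R := Num.sqrt (dotv v v).

End Calculus.

Section Norms.
Variables (R : realType) (n : nat).
Implicit Types (F : 'rV[R]_n -> R).

Definition is_norm F : Prop :=
  [/\ forall v, 0 <= F v,
      forall v, F v = 0 -> v = 0,
      forall (a : R) v, F (a *: v) = `|a| * F v
    & forall v w, F (v + w) <= F v + F w].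

Definition half_sq F : 'rV[R]_n -> R := fun v => 2^-1 * F v ^+ 2.

Definition pos_def (A : 'M[R]_n) : Prop :=
  forall v : 'rV[R]_n, v != 0 -> 0 < (v *m A *m v^T) 0 0.

Definition strongly_convex_norm F : Prop :=
  is_norm F /\ forall xi, xi != 0 -> pos_def (hess (half_sq F) xi).

End Norms.

Section ElementarySymmetric.
Variable R : realType.

(* The sign of the permutation carrying i to j if i is injective and j is a
   rearrangement of i, and 0 otherwise. *)
Definition gen_kronecker (n k : nat) (i j : {ffun 'I_k -> 'I_n}) : R :=
  \det (\matrix_(a < k, b < k) ((i a == j b)%:R : R)).

Definition Smx (n k : nat) (A : 'M[R]_n) : R :=
  (k`!%:R)^-1 *
  \sum_(i : {ffun 'I_k -> 'I_n}) \sum_(j : {ffun 'I_k -> 'I_n})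
    gen_kronecker i j * \prod_(a < k) A (i a) (j a).

Definition dSmx (n k : nat) (A : 'M[R]_n) (i j : 'I_n) : R :=
  'D_(delta_mx i j) (@Smx n k) A.

Definition Svec (m k : nat) (lambda : 'rV[R]_m) : R :=
  \sum_(I : {set 'I_m} | #|I| == k) \prod_(i in I) lambda 0 i.

End ElementarySymmetric.

Section Anisotropic.
Variables (R : realType) (n : nat).
Implicit Types (F u : 'rV[R]_n -> R) (M : set 'rV[R]_n) (p x : 'rV[R]_n).
Implicit Types (nu g : 'rV[R]_n -> 'rV[R]_n).

Definition aniso_hess F u x : 'M[R]_n :=
  \matrix_(i, j) \sum_l hess (half_sq F) (grad u x) i l * hess u x l j.

Definition level_set (Omega : set 'rV[R]_n) u (t : R) : set 'rV[R]_n :=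
  [set x | Omega x /\ u x = t].

Definition level_normal u x : 'rV[R]_n := (enorm (grad u x))^-1 *: grad u x.

Definition aniso_normal F nu x : 'rV[R]_n := grad F (nu x).

(* The differential at [p] of the restriction of [g] to [M] is [v |-> v *m L]
   for v in T_pM, i.e. (g o c)'(0) = dg_p(c'(0)) for curves c in M through p.
   Only the values of [L] on T_pM are constrained. *)
Definition is_differential_on M g p (L : 'M[R]_n) : Prop :=
  forall c : R -> 'rV[R]_n,
    c 0 = p -> (\forall s \near (0 : R), M (c s)) ->
    derivable c (0 : R) (1 : R) ->
    is_derive (0 : R) (1 : R) (g \o c) ('D_1 c (0 : R) *m L).

(* The rows of [E] form a basis of the hyperplane orthogonal to [w] (w != 0). *)
Definition is_basis_orth (w : 'rV[R]_n) (E : 'M[R]_(n.-1, n)) : Prop :=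
  row_free E /\ E *m w^T = 0.

(* The entries of [kappa] are the eigenvalues, with multiplicity, of
   dnu_F : T_pM -> T_pM: both tangent spaces T_pM and T_{nu_F(p)}(dW) are
   nu(p)^perp, and [A] is the matrix of dnu_F in the basis [E] of it, in the
   row-vector convention. *)
Definition is_aniso_curvatures F M nu p (kappa : 'rV[R]_n.-1) : Prop :=
  exists (L : 'M[R]_n) (E : 'M[R]_(n.-1, n)) (A : 'M[R]_n.-1),
    [/\ is_differential_on M (aniso_normal F nu) p L,
        is_basis_orth (nu p) E,
        E *m L = A *m E
      & char_poly A = \prod_i ('X - (kappa 0 i)%:P)].

End Anisotropic.

(* Main.v *)
From HB Require Import structures.
Require Import Defs.
From mathcomp Require Import all_boot all_order all_algebra.
From mathcomp Require Import all_classical all_reals all_analysis.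
From mathcomp Require fingroup perm complex.
From mathcomp Require Import ring lra.

(* The S_k(A) are the coefficients of det(1 + 'X A), which is the same for XY
   and YX by Sylvester's identity, and which is affine in A along any rank-one
   direction.
   Write xi = grad u(x), H for the Hessian of F at xi and U for that of u at x.
   By homogeneity grad F(nu) = grad F(grad u) near x on the level set, so
   U H is the matrix of the differential of the anisotropic normal, and
   xi H = 0, H xi = 0. As the level set contains curves with any velocity
   orthogonal to xi, the differential is determined on that hyperplane. A basis
   E of it factors U H as X E, and E X is the matrix of the differential in this
   basis: hence S_k(kappa) = S_k(E X) = S_k(U H) = S_k(H U).
   The eigenvalues are real, because E X is the product of a symmetric matrix
   and of the symmetric positive definite matrix of H on the hyperplane.
   Finally A_F = F H U + grad F (x) b for some b; the sum over i and j is the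
   derivative of S_(k+1) at A_F in the direction grad F (x) xi, and is
   unaffected by b, so xi H = 0 and <xi, grad F> = F give F^(k+1) S_k(H U). *)

Set Implicit Arguments.
Unset Strict Implicit.
Unset Printing Implicit Defensive.

Import Order.TTheory GRing.Theory Num.Theory.
Import numFieldNormedType.Exports.

Local Open Scope ring_scope.

(** * Determinants *)

Section Determinants.
Variable R : comNzRingType.

Definition replace_rows n (J : {set 'I_n}) (X Y : 'M[R]_n) : 'M[R]_n :=
  \matrix_(i, j) if i \in J then X i j else Y i j.

(** In the Leibniz formula each product of sums expands over the set [J] of rows whose factor comes
    from [X]. *)
Lemma det_add n (X Y : 'M[R]_n) :
  \det (X + Y) = \sum_(J : {set 'I_n}) \det (replace_rows J X Y).
Proof.
rewrite /determinant exchange_big /=; apply: eq_bigr => s _.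
rewrite -big_distrr /=; congr (_ * _).
under eq_bigr do rewrite mxE.
rewrite bigA_distr; apply: eq_bigr => J _; apply: eq_bigr => i _.
by rewrite mxE.
Qed.

(** One block matrix has two block triangular factorizations, one for each Schur complement. *)
Lemma det_1_add_mulC m n (X : 'M[R]_(m, n)) (Y : 'M[R]_(n, m)) :
  \det (1%:M + X *m Y) = \det (1%:M + Y *m X).
Proof.
have E1 : block_mx 1%:M (- X) Y 1%:M =
    block_mx 1%:M 0 Y 1%:M *m block_mx 1%:M (- X) 0 (1%:M + Y *m X).
  rewrite mulmx_block ?mul1mx ?mul0mx ?mulmx0 ?mulmx1 ?addr0 ?add0r.
  by rewrite mulmxN addrC addrK.
have E2 : block_mx 1%:M (- X) Y 1%:M =
    block_mx (1%:M + X *m Y) (- X) 0 1%:M *m block_mx 1%:M 0 Y 1%:M.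
  rewrite mulmx_block ?mul1mx ?mul0mx ?mulmx0 ?mulmx1 ?addr0 ?add0r.
  by rewrite mulNmx addrK.
have := congr1 determinant E2; rewrite E1 !det_mulmx !det_ublock !det_lblock.
by rewrite !det1 !mul1r !mulr1.
Qed.

(** With [P] the selection matrix of [f], the submatrix is [1 + P^T (A - 1) P]. Sylvester's identity
    turns it into [1 + P P^T (A - 1)], which has the rows of [A] on the image of [f] and those of
    the identity elsewhere. *)
Lemma det_mxsub_inj n k (f : 'I_k -> 'I_n) (A : 'M[R]_n) : injective f ->
  \det (mxsub f f A) = \det (replace_rows [set f a | a in 'I_k] A 1%:M).
Proof.
move=> finj; pose P : 'M[R]_(n, k) := \matrix_(i, a) (i == f a)%:R.
have PTE m (Y : 'M[R]_(n, m)) : P^T *m Y = rowsub f Y.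
  apply/matrixP=> a j; rewrite !mxE (bigD1 (f a)) //= !mxE eqxx mul1r.
  by rewrite big1 ?addr0 // => i /negPf ia; rewrite !mxE ia mul0r.
have PE m (Y : 'M[R]_(m, n)) : Y *m P = colsub f Y.
  apply/matrixP=> a j; rewrite !mxE (bigD1 (f j)) //= !mxE eqxx mulr1.
  by rewrite big1 ?addr0 // => i /negPf ia; rewrite !mxE ia mulr0.
transitivity (\det (1%:M + (P^T *m (A - 1%:M)) *m P)).
  congr determinant; rewrite mulmxBr mulmx1 mulmxBl PTE PE PTE.
  apply/matrixP=> a b; rewrite !mxE (inj_eq finj).
  by rewrite addrCA subrr addr0.
rewrite -det_1_add_mulC PTE; congr determinant; apply/matrixP=> i j.
rewrite !mxE; case: ifP => [/imsetP[a _ ->]|iN].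
  rewrite (bigD1 a) //= big1 => [|b /negPf ba].
    by rewrite !mxE eqxx mul1r addr0 addrCA subrr addr0.
  by rewrite !mxE (inj_eq finj) eq_sym ba mul0r.
rewrite big1 ?addr0 // => b _; rewrite !mxE.
case: eqP => [ib|_]; rewrite ?mul0r //.
by rewrite ib imset_f in iN.
Qed.

End Determinants.

(** Matrix determinant lemma without inverses: both block identities are compared through
    determinants, and the factor [\det M] is cancelled. *)
Lemma det_add_mulmx_rank1 (R : idomainType) n (M : 'M[R]_n) (p : 'cV[R]_n)
    (q : 'rV[R]_n) : \det M != 0 ->
  \det (M + p *m q) = \det M + (q *m \adj M *m p) 0 0.
Proof.
move=> M0; set d := \det M.
have E1 : block_mx M (- p) q 1%:M *m
          block_mx 1%:M (\adj M *m p) 0 d%:M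
        = block_mx M 0 q (q *m \adj M *m p + d%:M).
  rewrite mulmx_block ?mulmx1 ?mulmx0 ?addr0 !mulmxA mul_mx_adj mul1mx.
  by rewrite mul_scalar_mx mul_mx_scalar scalerN subrr.
have E2 : block_mx M (- p) q 1%:M =
    block_mx 1%:M (- p) 0 1%:M *m block_mx (M + p *m q) 0 q 1%:M.
  rewrite mulmx_block ?mul1mx ?mul0mx ?mulmx0 ?mulmx1 ?addr0 ?add0r.
  by rewrite mulNmx addrK.
have := congr1 determinant E1; rewrite E2 !det_mulmx !det_ublock !det_lblock.
rewrite !det1 !mul1r mulr1 det_scalar1 det_mx11 !mxE mulr1n (mulrC _ d).
by move=> /(mulfI M0) ->; rewrite addrC.
Qed.

(** * The generating polynomial of the S_k *)

Section GeneratingPolynomial.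
Variable R : realType.
Import fingroup perm.

(** Expanding the Kronecker determinant over permutations [s], only the index map [j = i \o s]
    contributes; what remains is the Leibniz formula of a minor. *)
Lemma Smx_minors n k (A : 'M[R]_n) :
  Smx k A = (k`!%:R)^-1 * \sum_(f : {ffun 'I_k -> 'I_n}) \det (mxsub f f A).
Proof.
congr (_ * _); apply: eq_bigr => i _.
rewrite /gen_kronecker {2}/determinant.
under eq_bigr => j _ do rewrite /determinant big_distrl /=.
rewrite exchange_big /= [LHS](reindex_inj invg_inj) /=.
apply: eq_bigr => s _.
pose j0 : {ffun 'I_k -> 'I_n} := [ffun a => i (s a)].
rewrite (bigD1 j0) //= [X in _ + X]big1 ?addr0 => [|j jj0].
  rewrite odd_permV big1 ?mulr1; last first.
    by move=> a _; rewrite mxE ffunE permKV eqxx.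
  by congr (_ * _); apply: eq_bigr => a _; rewrite ffunE mxE.
have [a ja] : exists a, j a != j0 a.
  apply/existsP; apply: contraR jj0 => /existsPn jj0.
  by apply/eqP/ffunP => a; apply/eqP; rewrite -[_ == _]negbK.
rewrite [X in _ * X * _](bigD1 (s a)) //= mxE permK.
move: ja; rewrite ffunE eq_sym => /negPf ->.
by rewrite mul0r mulr0 mul0r.
Qed.

Lemma det_mxsub_ninj n k (f : 'I_k -> 'I_n) (A : 'M[R]_n) : ~ injective f ->
  \det (mxsub f f A) = 0.
Proof.
move=> /injectiveP/injectivePn[a [b ab fab]].
apply: (determinant_alternate ab) => c; by rewrite !mxE fab.
Qed.

Lemma Smx_principal n k (A : 'M[R]_n) :
  Smx k A = \sum_(J : {set 'I_n} | #|J| == k) \det (replace_rows J A 1%:M).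
Proof.
rewrite Smx_minors (bigID (fun f : {ffun 'I_k -> 'I_n} => injectiveb f)) /=.
rewrite [X in _ + X]big1 ?addr0; last first.
  by move=> f /injectiveP; exact: det_mxsub_ninj.
rewrite (partition_big (fun f : {ffun 'I_k -> 'I_n} => [set f a | a in 'I_k])
   (fun J => #|J| == k)) /=; last first.
  by move=> f /injectiveP finj; rewrite card_imset // card_ord.
rewrite big_distrr /=; apply: eq_bigr => J /eqP Jk.
rewrite (eq_bigr (fun=> \det (replace_rows J A 1%:M))); last first.
  by move=> f /andP[/injectiveP finj /eqP <-]; rewrite det_mxsub_inj.
rewrite sumr_const; set N := #|_|; have -> : N = k`!; last first.
  by rewrite mulrnAr -mulrnAl -[X in X * _ = _]mulr_natl divff ?mul1r.
have := card_inj_ffuns_on 'I_k (mem J); rewrite card_ord Jk ffactnn => <-.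
apply: eq_card => f; rewrite inE unfold_in; apply/andP/andP => -[].
  move=> /= finj /eqP <-; split=> //.
  by apply/ffun_onP => a; exact: imset_f.
move=> /= /ffun_onP fJ finj; split=> //; move/injectiveP in finj.
rewrite eqEcard card_imset // card_ord Jk leqnn andbT.
by apply/fintype.subsetP => _ /imsetP[a _ ->]; exact: fJ.
Qed.

Definition minor_poly n (A : 'M[R]_n) : {poly R} :=
  \det (1%:M + 'X *: map_mx polyC A).

Lemma coef_minor_poly n (A : 'M[R]_n) k : (minor_poly A)`_k = Smx k A.
Proof.
rewrite /minor_poly addrC det_add Smx_principal coef_sum.
rewrite [RHS]big_mkcond /=; apply: eq_bigr => J _.
(* Scaling the rows in [J] is left multiplication by a diagonal matrix of determinant ['X ^+ #|J|],
   so [J] contributes to that coefficient only. *)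
have -> : replace_rows J ('X *: map_mx polyC A) 1%:M =
    diag_mx (\row_i (if i \in J then 'X else 1)) *m
      map_mx polyC (replace_rows J A 1%:M).
  apply/matrixP=> i j; rewrite mul_diag_mx !mxE; case: ifP => //.
  by rewrite mul1r raddfMn.
rewrite det_mulmx det_diag det_map_mx.
under eq_bigr do rewrite mxE.
rewrite -big_mkcond /= prodr_const coefXnM coefC ltnNge.
case: ltngtP => [kJ|kJ|->]; rewrite ?subnn //= ?eqxx //.
by rewrite subn_eq0 leqNgt kJ.
Qed.

Lemma coef_prod_1_addX m k (kappa : 'rV[R]_m) :
  (\prod_i (1 + (kappa 0 i)%:P * 'X))`_k = Svec k kappa.
Proof.
under eq_bigr do rewrite addrC.
rewrite bigA_distr coef_sum /Svec [RHS]big_mkcond /=.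
apply: eq_bigr => J _; rewrite -big_mkcond /= big_split /= prodr_const.
rewrite -rmorph_prod /= coefCM coefXn eq_sym.
by case: eqP; rewrite ?mulr1 ?mulr0.
Qed.

End GeneratingPolynomial.

(** * Sylvester's identity, eigenvalues and rank-one perturbations *)

Section ElementarySymmetricOfMatrices.
Variable R : realType.

Lemma minor_poly_mulC m n (X : 'M[R]_(m, n)) (Y : 'M[R]_(n, m)) :
  minor_poly (X *m Y) = minor_poly (Y *m X).
Proof.
rewrite /minor_poly !map_mxM [in LHS]scalemxAl det_1_add_mulC.
by rewrite [in RHS]scalemxAr.
Qed.

Lemma Smx_mulmxC m n k (X : 'M[R]_(m, n)) (Y : 'M[R]_(n, m)) :
  Smx k (X *m Y) = Smx k (Y *m X).
Proof. by rewrite -!coef_minor_poly minor_poly_mulC. Qed.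

Lemma SmxZ n k (a : R) (A : 'M[R]_n) : Smx k (a *: A) = a ^+ k * Smx k A.
Proof.
rewrite !Smx_minors mulrCA; congr (_ * _); rewrite big_distrr /=.
apply: eq_bigr => f _; rewrite -detZ; congr determinant.
by apply/matrixP => i j; rewrite !mxE.
Qed.

Lemma horner_minor_poly n (A : 'M[R]_n) z :
  (minor_poly A).[z] = \det (1%:M + z *: A).
Proof.
rewrite /minor_poly -horner_evalE -det_map_mx; congr determinant.
apply/matrixP => i j.
by rewrite !mxE /= horner_evalE !hornerE hornerMn hornerC.
Qed.

Lemma minor_poly_neq0 n (A : 'M[R]_n) : minor_poly A != 0.
Proof.
apply/eqP => /(congr1 (horner^~ 0)).
rewrite horner_minor_poly scale0r addr0 det1 horner0 => /eqP.
by rewrite oner_eq0.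
Qed.

Lemma eq_poly_neq0 (p q : {poly R}) :
  (forall z, z != 0 -> p.[z] = q.[z]) -> p = q.
Proof.
move=> pq; apply/eqP; rewrite -subr_eq0; apply/eqP.
apply: (@roots_geq_poly_eq0 _ _ [seq i.+1%:R | i <- iota 0 (size (p - q))]).
- apply/allP => _ /mapP[i _ ->]; rewrite rootE hornerD hornerN.
  by rewrite pq ?subrr ?pnatr_eq0.
- rewrite map_inj_uniq ?iota_uniq// => i j /eqP.
  by rewrite eqr_nat eqSS => /eqP.
- by rewrite size_map size_iota.
Qed.

(** For [z != 0], [1 + z A = - z (- z^-1 - A)], so the value at [z] is [(- z) ^+ m] times the
    characteristic polynomial at [- z^-1]. *)
Lemma minor_poly_eigenvalues m (A : 'M[R]_m) (kappa : 'rV[R]_m) :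
  char_poly A = \prod_i ('X - (kappa 0 i)%:P) ->
  minor_poly A = \prod_i (1 + (kappa 0 i)%:P * 'X).
Proof.
move=> /(congr1 horner) cA; apply: eq_poly_neq0 => z z0.
rewrite horner_minor_poly horner_prod.
have -> : 1%:M + z *: A = (- z) *: ((- z^-1)%:M - A).
  rewrite scalerBr scale_scalar_mx mulrNN divff//.
  by rewrite scaleNr opprK.
rewrite detZ.
have -> : \det ((- z^-1)%:M - A) = (char_poly A).[- z^-1].
  rewrite /char_poly -horner_evalE -det_map_mx; congr determinant.
  apply/matrixP => i j.
  by rewrite !mxE /= horner_evalE !hornerE hornerMn hornerX.
rewrite cA horner_prod -[X in _ ^+ X]card_ord -prodr_const -big_split /=.
apply: eq_bigr => i _; rewrite !hornerE mulrDr mulrNN divff// mulrNN mulrC.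
by rewrite mulrC.
Qed.

Lemma Smx_eigenvalues n m k (X : 'M[R]_(n, m)) (E : 'M[R]_(m, n))
    (kappa : 'rV[R]_m) :
  char_poly (E *m X) = \prod_i ('X - (kappa 0 i)%:P) ->
  Smx k (X *m E) = Svec k kappa.
Proof.
move=> EX; rewrite Smx_mulmxC -coef_minor_poly -coef_prod_1_addX.
by rewrite (minor_poly_eigenvalues EX).
Qed.

(** The matrix determinant lemma is applied over polynomials, where [1 + 'X A] has non-zero
    determinant for every [A]: its value at 0 is 1. *)
Lemma minor_poly_rank1 n (A : 'M[R]_n) (p : 'cV[R]_n) (q : 'rV[R]_n) :
  minor_poly (A + p *m q) = minor_poly A +
    'X * (map_mx polyC q *m \adj (1%:M + 'X *: map_mx polyC A)
          *m map_mx polyC p) 0 0.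
Proof.
rewrite /minor_poly map_mxD map_mxM scalerDr addrA scalemxAl.
rewrite det_add_mulmx_rank1; last exact: minor_poly_neq0.
by rewrite -scalemxAr mxE.
Qed.

(** [delta_mx i j] has rank one, so [Smx k] is affine in this direction and the difference quotient
    is constant. *)
Lemma dSmxE n k (A : 'M[R]_n) i j : dSmx k A i j =
  ('X * \adj (1%:M + 'X *: map_mx polyC A) j i)`_k.
Proof.
set c := RHS.
have affine h : Smx k (h *: delta_mx i j + A) = Smx k A + h * c.
  rewrite addrC -(mul_delta_mx (0 : 'I_1)) scalemxAl -coef_minor_poly.
  rewrite minor_poly_rank1 coefD coef_minor_poly; congr (_ + _).
  rewrite map_mxZ -scalemxAr mxE mulrCA coefCM /c; congr (_ * ('X * _)`_k).
  by rewrite !map_delta_mx -rowE -colE !mxE.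
rewrite /dSmx /derive; apply: lim_near_cst => //.
near=> h; rewrite /= affine addrAC subrr add0r.
rewrite /= -[_ *: _]/(_ * _) mulKf//; near: h.
exact: nbhs_dnbhs_neq.
Unshelve. all: by end_near. Qed.

Lemma sum_dSmx_rank1 n k (A : 'M[R]_n) (p q : 'rV[R]_n) :
  \sum_i \sum_j dSmx k A i j * q 0 j * p 0 i =
  Smx k (A + p^T *m q) - Smx k A.
Proof.
rewrite -!coef_minor_poly minor_poly_rank1 coefD addrAC subrr add0r.
rewrite mxE big_distrr coef_sum /=; apply: eq_bigr => i _.
rewrite !mxE big_distrl big_distrr coef_sum /=; apply: eq_bigr => j _.
rewrite !mxE dSmxE mulrA mulrCA mulrA mulrAC coefMC; congr (_ * _).
by rewrite -mulrA coefCM [RHS]mulrC !mxE [in RHS](mulrC _ 'X).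
Qed.

(* By the matrix determinant lemma the sum does not depend on [b], so the
   rank-one term of the anisotropic Hessian does not contribute. *)
Lemma sum_dSmx_eigenvector n k (B : 'M[R]_n) (a b v : 'rV[R]_n) (phi : R) :
  v *m B = 0 -> v *m a^T = phi%:M ->
  \sum_i \sum_j dSmx k.+1 (phi *: B + a^T *m b) i j * v 0 j * a 0 i =
  phi ^+ k.+1 * Smx k B.
Proof.
move=> vB va; set C := phi *: B.
have vC : v *m C = 0 by rewrite -scalemxAr vB scaler0.
rewrite sum_dSmx_rank1 -addrA -mulmxDr -!coef_minor_poly !minor_poly_rank1.
rewrite -coefB opprD addrACA subrr add0r map_mxD !mulmxDl.
rewrite [X in 'X * X - _]mxE mulrDr addrAC subrr add0r.
transitivity (minor_poly (C + a^T *m v) - minor_poly C)`_k.+1.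
  by rewrite minor_poly_rank1 addrAC subrr add0r.
(* As [v C = 0], [1 + 'X (C + a^T v)] factors as [(1 + 'X a^T v) (1 + 'X C)]; by Sylvester's
   identity the first factor has determinant [1 + phi 'X]. *)
have -> : minor_poly (C + a^T *m v) =
    (1 + phi%:P * 'X) * minor_poly C.
  rewrite /minor_poly.
  have -> : 1%:M + 'X *: map_mx polyC (C + a^T *m v) =
     (1%:M + ('X *: map_mx polyC a^T) *m map_mx polyC v) *m
     (1%:M + 'X *: map_mx polyC C).
    rewrite mulmxDl mul1mx mulmxDr mulmx1 -[X in _ + (_ + X)]mulmxA.
    rewrite -[X in _ + (_ + _ *m X)]scalemxAr -map_mxM vC map_mx0 scaler0.
    by rewrite mulmx0 addr0 map_mxD scalerDr addrA map_mxM scalemxAl.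
  rewrite det_mulmx; congr (_ * _).
  rewrite det_1_add_mulC -scalemxAr -map_mxM va det_mx11 !mxE.
  by rewrite mulrC mulr1n.
rewrite mulrDl mul1r addrAC subrr add0r -mulrA coefCM coefXM /=.
by rewrite !coef_minor_poly SmxZ exprS mulrA.
Qed.

End ElementarySymmetricOfMatrices.

(** * Real spectrum *)

Section RealSpectrum.
Variable R : realType.
Import complex.

Let RC := real_complex R.

Lemma Re_sum n (w : 'I_n -> complex R) :
  Re (\sum_i w i) = \sum_i Re (w i).
Proof. by apply: (big_morph (@Re R)) => // -[? ?] [? ?]. Qed.

Lemma Im_sum n (w : 'I_n -> complex R) :
  Im (\sum_i w i) = \sum_i Im (w i).
Proof. by apply: (big_morph (@Im R)) => // -[? ?] [? ?]. Qed.

Lemma Re_mulmx_real n (w : 'rV[complex R]_n) (M : 'M[R]_n) :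
  map_mx (@Re R) (w *m map_mx RC M) = map_mx (@Re R) w *m M.
Proof.
apply/matrixP=> i j; rewrite !mxE Re_sum; apply: eq_bigr => k _.
by rewrite !mxE; case: (w i k) => a b /=; rewrite mulr0 subr0.
Qed.

Lemma Im_mulmx_real n (w : 'rV[complex R]_n) (M : 'M[R]_n) :
  map_mx (@Im R) (w *m map_mx RC M) = map_mx (@Im R) w *m M.
Proof.
apply/matrixP=> i j; rewrite !mxE Im_sum; apply: eq_bigr => k _.
by rewrite !mxE; case: (w i k) => a b /=; rewrite mulr0 add0r.
Qed.

Lemma symmetric_form n (N : 'M[R]_n) (a b : 'rV[R]_n) : N^T = N ->
  a *m N *m b^T = b *m N *m a^T.
Proof.
move=> NT; have -> : a *m N *m b^T = (b *m N *m a^T)^T.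
  by rewrite !trmx_mul trmxK NT mulmxA.
by apply/matrixP=> i j; rewrite mxE !ord1.
Qed.

(* For an eigenvector a + i b of M = K S with eigenvalue x + i y, the symmetry
   of M K = K S K forces y (a K a + b K b) = 0. *)
Lemma eigenvalue_mul_posdef_real n (S K : 'M[R]_n) (z : complex R) :
  S^T = S -> K^T = K -> pos_def K ->
  eigenvalue (map_mx RC (K *m S)) z -> Im z = 0.
Proof.
move=> ST KT Kpos /eigenvalueP[w wz w0].
set a := map_mx (@Re R) w; set b := map_mx (@Im R) w.
have aM : a *m (K *m S) = Re z *: a - Im z *: b.
  rewrite -Re_mulmx_real wz; apply/matrixP=> i j; rewrite !mxE.
  by case: (z) (w i j) => [? ?] [? ?].
have bM : b *m (K *m S) = Re z *: b + Im z *: a.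
  rewrite -Im_mulmx_real wz; apply/matrixP=> i j; rewrite !mxE.
  by case: (z) (w i j) => [? ?] [? ?].
have sym : a *m (K *m S *m K) *m b^T = b *m (K *m S *m K) *m a^T.
  by apply: symmetric_form; rewrite !trmx_mul ST KT !mulmxA.
have ab : a *m K *m b^T = b *m K *m a^T by exact: symmetric_form.
have E : Im z * ((a *m K *m a^T) 0 0 + (b *m K *m b^T) 0 0) = 0.
  move: sym; rewrite (mulmxA a) (mulmxA b) aM bM.
  rewrite !mulmxBl !mulmxDl -!scalemxAl ab => /matrixP/(_ 0 0).
  by rewrite !mxE; lra.
have nneg (c : 'rV[R]_n) : 0 <= (c *m K *m c^T) 0 0.
  have [->|c0] := eqVneq c 0; last exact/ltW/Kpos.
  by rewrite !mul0mx mxE.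
move/eqP: E; rewrite mulf_eq0 => /orP[/eqP //|].
rewrite paddr_eq0// => /andP[/eqP a0 /eqP b0]; exfalso.
move/negP: w0; apply.
have Z (c : 'rV[R]_n) : (c *m K *m c^T) 0 0 = 0 -> c = 0.
  by move=> c0; apply/eqP/negPn/negP => /Kpos; rewrite c0 ltxx.
apply/eqP/matrixP=> i j; rewrite mxE.
have /matrixP/(_ i j) := Z a a0; have /matrixP/(_ i j) := Z b b0.
by rewrite !mxE; case: (w i j) => p q /= -> ->.
Qed.

(** The polynomial splits over the complex numbers and all its roots are real, so their real parts
    split it over [R]. *)
Lemma char_poly_mul_posdef_split n (S K : 'M[R]_n) :
  S^T = S -> K^T = K -> pos_def K ->
  exists kappa : 'rV[R]_n,
    char_poly (S *m K) = \prod_i ('X - (kappa 0 i)%:P).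
Proof.
(* [S K] is the transpose of [K S]. *)
move=> ST KT Kpos; have -> : char_poly (S *m K) = char_poly (K *m S).
  rewrite /char_poly -det_tr /char_poly_mx linearB /= tr_scalar_mx.
  by rewrite map_trmx trmx_mul ST KT.
have [rs] := closed_field_poly_normal (char_poly (map_mx RC (K *m S))).
have /monicP -> := char_poly_monic (map_mx RC (K *m S)).
rewrite scale1r => rsE.
have rsreal z : z \in rs -> z = RC (Re z).
  rewrite -root_prod_XsubC -rsE -eigenvalue_root_char.
  move=> /(eigenvalue_mul_posdef_real ST KT Kpos).
  by case: z => p q /= ->.
have szrs : size rs = n.
  apply/eq_add_S; rewrite -(size_prod_XsubC rs id) -rsE.
  exact: size_char_poly.
exists (\row_i Re (nth 0 rs i)).
apply: (map_poly_inj (complex.real_complex R)).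
rewrite map_char_poly rsE rmorph_prod /=.
rewrite (big_nth 0) szrs big_mkord; apply: eq_bigr => i _.
rewrite rmorphB /= map_polyX map_polyC /= mxE.
congr ('X - _%:P); apply: rsreal.
by rewrite mem_nth// szrs.
Qed.

End RealSpectrum.

Local Open Scope classical_set_scope.
Local Open Scope ring_scope.

(** * Differential calculus on row vectors *)

Section MeanValue.
Variable R : realType.

Lemma cvg_is_derive (V W : normedModType R) (f : V -> W) a v l :
  h^-1 *: (f (h *: v + a) - f a) @[h --> 0^'] --> l -> is_derive a v f l.
Proof. by move=> fl; split; [apply/cvg_ex; exists l | exact: cvg_lim]. Qed.

Lemma is_derive_line (V W : normedModType R) (f : V -> W) x v (s : R) :
  derivable f (x + s *: v) v ->
  is_derive s 1 (fun r : R => f (x + r *: v)) ('D_v f (x + s *: v)).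
Proof.
move=> df; apply: cvg_is_derive.
rewrite (_ : (fun h => _) = (fun h : R => h^-1 *:
  ((f \o shift (x + s *: v)) (h *: v) - f (x + s *: v)))); first exact: df.
apply/funext => h /=; congr (_ *: (f _ - _)).
by rewrite [h *: 1]mulr1 scalerDl addrCA.
Qed.

(** Treats both signs of [a] at once, as coordinate increments can have either sign. *)
Lemma mean_value0 (g dg : R -> R) (a : R) :
  (forall s : R, `|s| <= `|a| -> is_derive s 1 g (dg s)) ->
  exists2 s, `|s| <= `|a| & g a - g 0 = a * dg s.
Proof.
move=> gdg.
have gc (l r : R) : (forall s, s \in `[l, r] -> `|s| <= `|a|) ->
    {within `[l, r], continuous g}.
  move=> lr; apply: derivable_within_continuous => s /lr /gdg ?.
  exact: ex_derive.
have [a0|/ltW a0] := leP 0 a.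
- have H s : s \in `[0, a] -> `|s| <= `|a|.
    by rewrite in_itv /= => /andP[s0 sa]; rewrite !ger0_norm.
  have [s sa E] := MVT_segment a0
    (fun s sa => gdg s (H s (subset_itv_oo_cc sa))) (gc _ _ H).
  by exists s; [exact: H|rewrite E subr0 mulrC].
- have H s : s \in `[a, 0] -> `|s| <= `|a|.
    by rewrite in_itv /= => /andP[s0 sa]; rewrite !ler0_norm ?lerN2.
  have [s sa E] := MVT_segment a0
    (fun s sa => gdg s (H s (subset_itv_oo_cc sa))) (gc _ _ H).
  by exists s; [exact: H|rewrite -opprB E sub0r mulrN opprK mulrC].
Qed.

Lemma differentiable_increment (V W : normedModType R) (f : V -> W) x
    (d : {linear V -> W}) : continuous d ->
  (forall e : R, 0 < e ->
    \forall h \near (0 : V), `|f (h + x) - f x - d h| <= e * `|h|) ->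
  differentiable f x.
Proof.
move=> dc fd.
have fo : f \o shift x = cst (f x) + d +o_ 0 id.
  apply/eqaddoP => _/posnumP[e]; near=> h.
  rewrite -![(_ + _ : _ -> _) _]/(_ + _) -![(- _ : _ -> _) _]/(- _) /=.
  rewrite -![(_ + _ : _ -> _) _]/(_ + _) /cst opprD addrA.
  by near: h; exact: fd.
by apply/diff_locallyP; rewrite (diff_unique dc fo).
Unshelve. all: by end_near. Qed.

End MeanValue.

(** * Differentiability from continuous partial derivatives *)

Section RowVectors.
Variables (R : realType) (n : nat).
Implicit Types (f : 'rV[R]_n -> R) (x h : 'rV[R]_n).

Lemma normr_coord_le h i : `|h 0 i| <= `|h|.
Proof.
rewrite [leRHS]/Num.Def.normr /= mx_normrE.
exact: (le_bigmax _ (fun ij => `|h ij.1 ij.2|) (0, i)).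
Qed.

Lemma rV_norm_le h e : 0 <= e -> (forall i, `|h 0 i| <= e) -> `|h| <= e.
Proof.
move=> e0 he; rewrite [leLHS]/Num.Def.normr /= mx_normrE.
by apply: bigmax_le => // -[i j] _ /=; rewrite ord1.
Qed.

Lemma derive_dotv f x w : differentiable f x -> 'D_w f x = dotv w (grad f x).
Proof.
move=> df; rewrite deriveE// {1}(row_sum_delta w) linear_sum /=.
by apply: eq_bigr => i _; rewrite linearZ mxE /partial deriveE.
Qed.

Lemma Ck_onW k (D : set 'rV[R]_n) f : Ck_on k.+1 D f -> Ck_on k D f.
Proof.
elim: k f => [|k IH] f [fc fd]; split=> // i.
by have [? ?] := fd i; split=> //; exact: IH.
Qed.

Lemma dotv_linear x : linear ((fun v => dotv v x) : 'rV[R]_n -> R).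
Proof.
move=> a u v; rewrite /dotv scaler_sumr -big_split; apply: eq_bigr => i _ /=.
by rewrite !mxE mulrDl -mulrA.
Qed.

Lemma dotv_continuous x : continuous ((fun v => dotv v x) : 'rV[R]_n -> R).
Proof.
apply: (@continuous_big _ _ +%R 0 _ add_continuous) => i _ y.
exact: (cvgM (@coord_continuous R 1 n 0 i y) (cvg_cst (x 0 i))).
Qed.

(* Telescoping along the coordinate directions, with the mean value theorem
   on each segment. *)
Lemma C1_increment (D : set 'rV[R]_n) f x e : open D -> Ck_on 1 D f -> D x ->
  0 < e ->
  \forall h \near (0 : 'rV[R]_n),
    `|f (h + x) - f x - dotv h (grad f x)| <= e * `|h|.
Proof.
(* Each of the [n] coordinate steps costs at most [e' * |h|]; [n.+1] keeps the divisor positive when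
   [n = 0]. *)
move=> oD [_ fd] Dx e0; pose e' := e / n.+1%:R.
have e'0 : 0 < e' by rewrite divr_gt0.
have : \forall y \near x, D y /\
    forall i, `|partial i f x - partial i f y| <= e'.
  have nD : \forall y \near x, D y by exact: open_nbhs_nbhs.
  have nP : \forall y \near x, forall i, `|partial i f x - partial i f y| <= e'.
    suff : forall i, \forall y \near x, `|partial i f x - partial i f y| <= e'.
      exact: (@filter_forall _ _ _ (nbhs x) (nbhs_filter x)).
    move=> i; have [_ [+ _]] := fd i.
    by move=> /(_ x Dx)/cvgrPdist_le/(_ _ e'0).
  by near=> y; split; [near: y|near: y].
move=> /nbhs_ballP[d /= d0 dH].
have /filterS : \forall h \near (0 : 'rV[R]_n), `|h| < d by exact: nbhs0_lt.
apply => h hd.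
have inball k : `|k| <= `|h| -> D (x + k) /\
    forall i, `|partial i f (x + k) - partial i f x| <= e'.
  move=> kh; have [|? H] := dH (x + k).
    by rewrite -ball_normE /= opprD addrA subrr sub0r normrN (le_lt_trans kh).
  by split=> // i; rewrite distrC.
(* [z] runs from [x] to [x + h], adding one coordinate of [h] at a time. *)
pose z m : 'rV[R]_n := x + \row_i (if (i < m)%N then h 0 i else 0).
have -> : f (h + x) - f x = \sum_(m < n) (f (z m.+1) - f (z m)).
  rewrite -(big_mkord xpredT (fun m => f (z m.+1) - f (z m))) telescope_sumr//.
  congr (f _ - f _).
    by apply/rowP => i; rewrite !mxE ltn_ord addrC.
  by apply/rowP => i; rewrite !mxE addr0.
rewrite /dotv -sumrB.
apply: le_trans (ler_norm_sum _ _ _) _.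
apply: (@le_trans _ _ (\sum_(m < n) e' * `|h|)); last first.
  rewrite sumr_const card_ord -mulr_natl mulrA ler_wpM2r//.
  by rewrite /e' mulrA ler_pdivrMr// mulrC ler_pM2l// ler_nat.
apply: ler_sum => m _.
have zS : z m.+1 = z m + h 0 m *: delta_mx 0 m.
  apply/rowP => i; rewrite !mxE eqxx /= ltnS -addrA; congr (_ + _).
  have [->|im] := eqVneq i m; first by rewrite leqnn ltnn add0r mulr1.
  by rewrite mulr0 addr0 [in RHS]ltn_neqAle val_eqE im.
(* Since the norm is the sup norm, the points of each segment are no further from [x] than [|h|]. *)
have zD s : `|s| <= `|h 0 m| ->
    exists2 k, `|k| <= `|h| & z m + s *: delta_mx 0 m = x + k.
  move=> sh.
  exists (\row_i (if (i < m)%N then h 0 i else 0) + s *: delta_mx 0 m).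
    apply: rV_norm_le => // i; rewrite !mxE eqxx /=.
    have [->|im] := eqVneq i m.
      by rewrite ltnn add0r mulr1 (le_trans sh)// normr_coord_le.
    by rewrite mulr0 addr0; case: ifP; rewrite ?normr0// normr_coord_le.
  by rewrite addrA.
have /mean_value0[s sh] : forall s : R, `|s| <= `|h 0 m| ->
    is_derive s 1 (fun r => f (z m + r *: delta_mx 0 m))
      (partial m f (z m + s *: delta_mx 0 m)).
  move=> s sh; apply: is_derive_line; have [k kh ->] := zD s sh.
  by have [Dk _] := inball k kh; have [+ _] := fd m; exact.
rewrite -zS scale0r addr0 => ->; have [k kh ->] := zD s sh.
have [_ /(_ m) H] := inball k kh.
rewrite [X in _ - _ * X]mxE -mulrBr normrM mulrC.
by apply: ler_pM => //; exact: normr_coord_le.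
Unshelve. all: by end_near. Qed.

Lemma C1_differentiable (D : set 'rV[R]_n) f x :
  open D -> Ck_on 1 D f -> D x -> differentiable f x.
Proof.
move=> oD fC1 Dx; pose d v := dotv v (grad f x).
pose dM := GRing.isLinear.Build _ _ _ _ d (dotv_linear (grad f x)).
pose dL : {linear 'rV[R]_n -> R} := HB.pack d dM.
have dc : continuous dL by exact: dotv_continuous.
apply: (differentiable_increment dc) => e e0.
exact: (C1_increment oD fC1 Dx).
Qed.

End RowVectors.

(** * Symmetry of the Hessian and chain rules along curves *)

Section SecondDerivatives.
Variables (R : realType) (n : nat).
Implicit Types (f : 'rV[R]_n -> R) (x : 'rV[R]_n) (D : set 'rV[R]_n).

(** The mean value theorem is used in direction [i] on the difference of [f] along two parallel
    lines, then in direction [j] on [partial i f]. *)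
Lemma second_difference D f x i j (s : R) : Ck_on 2 D f ->
  (forall k, `|k| <= 2 * `|s| -> D (x + k)) ->
  exists2 k, `|k| <= 2 * `|s| &
    f (x + s *: delta_mx 0 j + s *: delta_mx 0 i) - f (x + s *: delta_mx 0 i)
      - (f (x + s *: delta_mx 0 j) - f x)
    = s * (s * partial j (partial i f) (x + k)).
Proof.
move=> [_ fC] ball; have [fi [_ fC1]] := fC i; have [fij _] := fC1 j.
have normE (a b : R) : `|a| <= `|s| -> `|b| <= `|s| ->
    `|a *: delta_mx 0 i + b *: delta_mx 0 j : 'rV[R]_n| <= 2 * `|s|.
  move=> sa sb; have d1 l : `|delta_mx 0 l : 'rV[R]_n| <= 1.
    apply: rV_norm_le => // l'; rewrite mxE.
    by case: andP; rewrite ?normr1 ?normr0.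
  apply: le_trans (ler_normD _ _) _; rewrite mulr2n mulrDl mul1r !normrZ.
  by apply: lerD; rewrite -[leRHS]mulr1; apply: ler_pM.
have /mean_value0[r rs] : forall r : R, `|r| <= `|s| -> is_derive r 1
    (fun r => f (x + s *: delta_mx 0 j + r *: delta_mx 0 i)
              - f (x + r *: delta_mx 0 i))
    (partial i f (x + s *: delta_mx 0 j + r *: delta_mx 0 i)
              - partial i f (x + r *: delta_mx 0 i)).
  move=> r rs; apply: is_deriveB; apply: is_derive_line; apply: fi.
    by rewrite -addrA [_ *: _ + _]addrC; apply/ball/normE.
  have := normE r 0 rs; rewrite normr0 scale0r addr0 => H.
  exact/ball/H.
have /mean_value0[q qs] : forall q : R, `|q| <= `|s| -> is_derive q 1
    (fun q => partial i f (x + r *: delta_mx 0 i + q *: delta_mx 0 j))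
    (partial j (partial i f) (x + r *: delta_mx 0 i + q *: delta_mx 0 j)).
  move=> q qs; apply: is_derive_line; apply: fij.
  by rewrite -addrA; apply/ball/normE.
rewrite !scale0r !addr0 => E2 E1.
exists (r *: delta_mx 0 i + q *: delta_mx 0 j); first exact: normE.
by rewrite E1 addrAC E2 addrA.
Qed.

(** The second difference is symmetric in [i] and [j], so the two mixed partials agree at two points
    near [x]; continuity brings both points to [x]. *)
Lemma hess_symmetric D f x : open D -> Ck_on 2 D f -> D x ->
  (hess f x)^T = hess f x.
Proof.
move=> oD fC2 Dx; apply/matrixP => i j; rewrite !mxE.
apply/eqP; rewrite -subr_eq0 -normr_le0; apply/ler_addgt0Pr => e e0.
rewrite add0r.
have cont k l : \forall y \near x,
    `|partial k (partial l f) x - partial k (partial l f) y| <= e / 2.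
  have [_ fC] := fC2; have [_ [_ fC1]] := fC l; have [_ [fkl _]] := fC1 k.
  by move/cvgrPdist_le: (fkl x Dx); apply; rewrite divr_gt0.
have : \forall y \near x, [/\ D y,
    `|partial i (partial j f) x - partial i (partial j f) y| <= e / 2 &
    `|partial j (partial i f) x - partial j (partial i f) y| <= e / 2].
  have nD : \forall y \near x, D y by exact: open_nbhs_nbhs.
  by apply: filterS3 nD (cont i j) (cont j i) => y.
move=> /nbhs_ballP[d /= d0 dH].
(* The intermediate points are within [2 s = d / 2] of [x]. *)
pose s := d / 4; have s0 : 0 < s by rewrite divr_gt0.
have inball k : `|k| <= 2 * `|s| -> ball x d (x + k).
  move=> ks; rewrite -ball_normE /= opprD addrA subrr sub0r normrN.
  by rewrite (le_lt_trans ks)// gtr0_norm// /s; lra.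
have Dball k : `|k| <= 2 * `|s| -> D (x + k) by move=> /inball/dH[].
have [k ks] := second_difference i j fC2 Dball.
have [l ls] := second_difference j i fC2 Dball.
have [_ _] := dH _ (inball _ ks); have [_ + _] := dH _ (inball _ ls).
move: (partial j _ (x + k)) (partial i _ (x + l)) => A B HB HA lE kE.
have cancel (a b : R) : s * (s * a) = s * (s * b) -> a = b.
  by move=> /(mulfI (lt0r_neq0 s0))/(mulfI (lt0r_neq0 s0)).
have AB : A = B by apply: cancel; rewrite -kE -lE (addrAC x); ring.
move: HA HB; rewrite AB; move: (partial j _ x) (partial i _ x) => a b HA HB.
rewrite -(subrKA B) -(opprB B).
apply: le_trans (ler_normD _ _) _; rewrite normrN (distrC B).
by rewrite [leRHS](splitr e) lerD// distrC.
Qed.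

Lemma is_derive_rV (q : R -> 'rV[R]_n) (s : R) (w : 'rV[R]_n) :
  (forall i, is_derive s 1 (fun r => q r 0 i) (w 0 i)) -> is_derive s 1 q w.
Proof.
move=> qw; have dq : derivable q s 1.
  by apply/derivable_mxP => i j; rewrite ord1; have [] := qw j.
split=> //; rewrite derive_mx//; apply/rowP => i; rewrite mxE.
by have [] := qw i.
Qed.

Lemma is_derive_curve (V : normedModType R) (g : V -> R) (c : R -> V)
    (s : R) (w : V) :
  differentiable g (c s) -> is_derive s 1 c w ->
  is_derive s 1 (g \o c) ('D_w g (c s)).
Proof.
move=> dg [/derivable1_diffP dc cw].
have dgc : differentiable (g \o c) s by exact: differentiable_comp.
split; first exact/derivable1_diffP.
by rewrite !deriveE// diff_comp//= -cw deriveE.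
Qed.

Lemma is_derive_grad_curve f (c : R -> 'rV[R]_n) (s : R) (w : 'rV[R]_n) :
  (forall j, differentiable (partial j f) (c s)) -> is_derive s 1 c w ->
  is_derive s 1 (fun r => grad f (c r)) (w *m hess f (c s)).
Proof.
move=> df cw; apply: is_derive_rV => j.
rewrite (_ : (fun r => _) = partial j f \o c); last first.
  by apply/funext => r; rewrite mxE.
rewrite (_ : (w *m _) 0 j = 'D_w (partial j f) (c s)).
  exact: is_derive_curve.
by rewrite derive_dotv// mxE /dotv; apply: eq_bigr => i _; rewrite !mxE.
Qed.

End SecondDerivatives.

(** * Curves in level sets *)

Section LevelCurves.
Variables (R : realType) (n : nat).
Implicit Types (u : 'rV[R]_n -> R) (t : R).
Implicit Types (x g w h : 'rV[R]_n) (D : set 'rV[R]_n).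

Lemma dotvD h k x : dotv (h + k) x = dotv h x + dotv k x.
Proof. by rewrite -[h]scale1r dotv_linear !scale1r. Qed.

Lemma dotvZ (a : R) h x : dotv (a *: h) x = a * dotv h x.
Proof.
rewrite -[a *: h]addr0 dotv_linear [X in _ + X](_ : _ = 0) ?addr0//.
by rewrite /dotv big1 // => i _; rewrite mxE mul0r.
Qed.

Lemma dotv_gt0 g : g != 0 -> 0 < dotv g g.
Proof.
move=> g0; have [i gi] : exists i, g 0 i != 0.
  apply/existsP; apply: contraR g0 => /existsPn g0; apply/eqP/rowP => i.
  by rewrite mxE; apply/eqP; rewrite -[_ == _]negbK.
rewrite /dotv (bigD1 i) //= ltr_pwDl//.
  by rewrite -expr2 exprn_even_gt0.
by apply: sumr_ge0 => j _; rewrite -expr2 sqr_ge0.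
Qed.

Definition level_offset D u t x g w (s r : R) : Prop :=
  D (x + (s *: w + r *: g)) /\ u (x + (s *: w + r *: g)) = t.

(** Intermediate value theorem along the gradient: [w] is tangent, so at offsets [e |s|] and
    [- e |s|] the first-order change of [u] is [e |s| N] up to sign, and the error does not exceed
    it. *)
Lemma level_offset_exists D u x w (e : R) : open D -> Ck_on 1 D u -> D x ->
  grad u x != 0 -> dotv w (grad u x) = 0 -> 0 < e ->
  \forall s \near (0 : R), exists2 h : R, `|h| <= e * `|s| &
    level_offset D u (u x) x (grad u x) w s h.
Proof.
move=> oD uC1 Dx; set g := grad u x => g0 wg e0.
have N0 := dotv_gt0 g0; set N := dotv g g in N0.
(* [C |s|] bounds the displacement when the offset is at most [e |s|]. With the constant
   [e * N / (C + 1)] below, the first-order error is then at most [e |s| N]. *)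
pose C := `|w| + e * `|g|.
have C0 : 0 < C + 1 by rewrite ltr_pwDr// addr_ge0// mulr_ge0// ltW.
have eta0 : 0 < e * N / (C + 1) by rewrite divr_gt0// mulr_gt0.
have nD : \forall y \near x, D y by exact: open_nbhs_nbhs.
have [d1 /= d10 Hd1] := (nbhs_ballP _ _).1 nD.
have [d2 /= d20 Hd2] := (nbhs_ballP _ _).1 (C1_increment oD uC1 Dx eta0).
pose d := Num.min d1 d2; have d0 : 0 < d by rewrite lt_min d10.
have small : \forall s \near (0 : R), `|s| < d / (C + 1).
  by apply: nbhs0_lt; rewrite divr_gt0.
apply: filterS small => s sd.
have kC (h : R) : `|h| <= e * `|s| -> `|s *: w + h *: g| <= `|s| * C.
  move=> hs; apply: le_trans (ler_normD _ _) _; rewrite !normrZ mulrDr.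
  by rewrite lerD2l mulrA ler_wpM2r// mulrC.
have kd (h : R) : `|h| <= e * `|s| -> `|s *: w + h *: g| < d.
  move=> /kC /le_lt_trans; apply.
  move: sd; rewrite ltr_pdivlMr//; apply: le_lt_trans.
  by rewrite ler_wpM2l// lerDl.
have kD (h : R) : `|h| <= e * `|s| -> D (x + (s *: w + h *: g)).
  move=> /kd kd'; apply: Hd1; rewrite -ball_normE /= opprD addrA subrr sub0r.
  by rewrite normrN (lt_le_trans kd')// ge_min lexx.
have inc (h : R) : `|h| <= e * `|s| ->
    `|u (x + (s *: w + h *: g)) - u x - h * N| <= e * `|s| * N.
  move=> hs; have := Hd2 (s *: w + h *: g); rewrite -ball_normE /= sub0r normrN.
  rewrite dotvD !dotvZ wg mulr0 add0r (addrC _ x) -/N.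
  have -> : `|s *: w + h *: g| < d2.
    by rewrite (lt_le_trans (kd h hs))// ge_min lexx orbT.
  move=> /(_ isT) H; apply: le_trans H _.
  apply: (@le_trans _ _ (e * N / (C + 1) * (`|s| * (C + 1)))).
    rewrite ler_pM2l//; apply: le_trans (kC h hs) _.
    by rewrite ler_wpM2l// lerDl.
  by rewrite [`|s| * _]mulrC mulrA divfK ?gt_eqF// mulrAC.
pose r := e * `|s|; have r0 : 0 <= r by rewrite mulr_ge0// ltW.
have rr : `|r| <= e * `|s| by rewrite ger0_norm.
have Nrr : `|- r| <= e * `|s| by rewrite normrN.
have cont : {within `[- r, r],
    continuous (fun h : R => u (x + (s *: w + h *: g)))}.
  apply: continuous_in_subspaceT => h; rewrite inE /= in_itv /= => hr.
  have hs : `|h| <= e * `|s| by rewrite ler_norml.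
  apply: continuous_comp; last by have [uc _] := uC1; apply/uc/kD.
  apply: cvgD; first exact: cvg_cst.
  apply: cvgD; first exact: cvg_cst.
  by apply: cvgZl; exact: cvg_id.
have uxr : Num.min (u (x + (s *: w + - r *: g))) (u (x + (s *: w + r *: g)))
    <= u x <=
    Num.max (u (x + (s *: w + - r *: g))) (u (x + (s *: w + r *: g))).
  have := inc r rr; have := inc (- r) Nrr.
  rewrite !ler_norml -/r => /andP[_ H1] /andP[H2 _].
  by rewrite ge_min le_max; apply/andP; split; apply/orP; [left|right]; lra.
have rNr : - r <= r by rewrite (le_trans _ r0)// oppr_le0.
have [h hr uh] := IVT rNr cont uxr.
have hs : `|h| <= e * `|s| by move: hr; rewrite in_itv /= ler_norml.
by exists h => //; split=> //; exact: kD.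
Qed.

(* The offset is chosen minimal up to [s ^+ 2], which makes it [o(s)] without
   any uniqueness argument. *)
Lemma level_curve D u x w : open D -> Ck_on 1 D u -> D x ->
  grad u x != 0 -> dotv w (grad u x) = 0 ->
  exists c : R -> 'rV[R]_n,
    [/\ c 0 = x, \forall s \near (0 : R), D (c s) /\ u (c s) = u x
      & is_derive (0 : R) (1 : R) c w].
Proof.
move=> oD uC1 Dx g0 wg; set g := grad u x in g0 wg *.
pose P := level_offset D u (u x) x g w.
have ex e : 0 < e -> \forall s \near (0 : R),
    exists2 h : R, `|h| <= e * `|s| & P s h.
  by move=> e0; exact: level_offset_exists.
have /choice[h hP] : forall s : R, exists h : R, (s = 0 -> h = 0) /\
    forall h' : R, P s h' -> P s h /\ `|h| <= `|h'| + s ^+ 2.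
  move=> s; have [->|s0] := eqVneq s 0.
    exists 0; split=> // h' _; split; last by rewrite normr0 addr_ge0// sqr_ge0.
    by rewrite /P /level_offset !scale0r !addr0.
  have [[h1 Ph1]|nP] := pselect (exists h : R, P s h); last first.
    by exists 0; split=> // h' Ph'; case: nP; exists h'.
  pose E := [set `|h| | h in P s].
  have lbE : lbound E 0 by move=> _ [h _ <-].
  have iE : has_inf E by split; [exists `|h1|, h1|exists 0].
  have s20 : 0 < s ^+ 2 by rewrite exprn_even_gt0.
  have [_ [h Ph <-] hE] := inf_adherent s20 iE.
  exists h; split=> [s0'|h' Ph']; first by rewrite s0' eqxx in s0.
  split=> //; apply: ltW (lt_le_trans hE _); rewrite lerD2r.
  by apply: ge_inf; [exists 0|exists h'].
have h00 : h 0 = 0 by have [->] := hP 0.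
exists (fun s => x + (s *: w + h s *: g)); split.
- by rewrite h00 !scale0r !addr0.
(* Any bound on the offset serves here: once some offset exists, the chosen one is on the level
   set. *)
- apply: filterS (ex 1 ltr01) => s [h' _ Ph'].
  by have [_ /(_ h' Ph')[]] := hP s.
apply: cvg_is_derive; apply/cvgrPdist_le => e e0.
(* The chosen offset will be at most [2 e' |s|], and [2 e' |g| <= e]. *)
pose e' := e / (2 * (`|g| + 1)).
have e'0 : 0 < e' by rewrite divr_gt0// mulr_gt0// ltr_wpDl.
near=> s.
have s0 : s != 0 by near: s; exact: nbhs_dnbhs_neq.
have se : `|s| <= e' by near: s; apply: dnbhs0_le.
have [h' h's Ph'] : exists2 h : R, `|h| <= e' * `|s| & P s h.
  by near: s; apply: nbhs_dnbhs; exact: ex.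
have [_ /(_ h' Ph')[_ hs]] := hP s.
rewrite h00 !scale0r !addr0 [s *: 1]mulr1 addrAC subrr add0r scalerDr.
rewrite scalerA mulVf// scale1r opprD addrA subrr sub0r normrN scalerA normrZ.
(* The slack [s ^+ 2] is at most [e' |s|] because [|s| <= e']. *)
have {}hs : `|h s| <= 2 * e' * `|s|.
  apply: le_trans hs _; rewrite -mulrA mulr2n mulrDl mul1r; apply: lerD => //.
  by rewrite -real_normK ?num_real// expr2 ler_wpM2r.
apply: (@le_trans _ _ (2 * e' * `|g|)).
  rewrite ler_wpM2r// normrM normfV mulrC ler_pdivrMr//.
  by rewrite normr_gt0.
rewrite /e' (_ : 2 * _ = e / (`|g| + 1)); last first.
  by field; rewrite gt_eqF// ltr_wpDl.
by rewrite mulrAC ler_pdivrMr ?ltr_wpDl// ler_pM2l// lerDl.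
Unshelve. all: by end_near. Qed.

End LevelCurves.

(** * Smooth norms *)

Section SmoothNorms.
Variables (R : realType) (n : nat) (F : 'rV[R]_n -> R).
Hypotheses (F_norm : is_norm F) (F_C2 : Ck_on 2 [set xi | xi != 0] F).
Implicit Types (y v : 'rV[R]_n).

Let open_neq0 : open [set xi : 'rV[R]_n | xi != 0].
Proof.
rewrite (_ : [set _ | _] = ~` [set 0]).
  exact/closed_openC/accessible_closed_set1/hausdorff_accessible/norm_hausdorff.
by apply/seteqP; split=> v /= /eqP.
Qed.

Let near_neq0 y : y != 0 -> \forall z \near y, z != 0.
Proof. by move=> y0; exact: open_nbhs_nbhs. Qed.

Lemma norm_gt0 y : y != 0 -> 0 < F y.
Proof.
move=> y0; case: F_norm => F0 F00 _ _; rewrite lt_neqAle F0 andbT eq_sym.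
by apply: contra_neq y0 => /F00.
Qed.

Lemma norm_pscale (c : R) y : 0 <= c -> F (c *: y) = c * F y.
Proof. by move=> c0; case: F_norm => _ _ -> _; rewrite ger0_norm. Qed.

Lemma norm_differentiable y : y != 0 -> differentiable F y.
Proof. exact: (C1_differentiable open_neq0 (Ck_onW F_C2)). Qed.

Lemma partial_norm_differentiable j y : y != 0 ->
  differentiable (partial j F) y.
Proof.
by case: F_C2 => _ /(_ j)[_ FC1]; exact: (C1_differentiable open_neq0 FC1).
Qed.

Lemma derive_norm_pscale (c : R) y v : 0 < c -> y != 0 ->
  'D_v F (c *: y) = 'D_v F y.
Proof.
move=> c0 y0.
have cy0 : c *: y != 0 by rewrite scaler_eq0 negb_or gt_eqF.
have line z u : z != 0 ->
    is_derive (0 : R) 1 (fun r => F (z + r *: u)) ('D_u F z).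
  move=> z0; have H : derivable F (z + (0 : R) *: u) u.
    by rewrite scale0r addr0; exact/diff_derivable/norm_differentiable.
  by have := is_derive_line H; rewrite scale0r addr0.
have [_ <-] := line _ v cy0.
(* Homogeneity moves [c] outside and rescales the direction to [c^-1 v]; the two factors cancel
   after differentiation. *)
have -> : (fun r : R => F (c *: y + r *: v)) =
    c *: (fun r : R => F (y + r *: (c^-1 *: v))).
  apply/funext => r; rewrite -[RHS]/(c * F _) -norm_pscale ?ltW// scalerDr.
  by rewrite !scalerA mulrAC divff ?gt_eqF// mul1r.
have [_ ->] := is_deriveZ c (line y (c^-1 *: v) y0).
rewrite !derive_dotv ?dotvZ; try exact: norm_differentiable.
by rewrite [LHS]mulrA divff ?gt_eqF// mul1r.
Qed.

Lemma partial_norm_pscale j (c : R) y : 0 < c -> y != 0 ->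
  partial j F (c *: y) = partial j F y.
Proof. exact: derive_norm_pscale. Qed.

Lemma grad_norm_pscale (c : R) y : 0 < c -> y != 0 ->
  grad F (c *: y) = grad F y.
Proof.
by move=> c0 y0; apply/rowP => j; rewrite !mxE partial_norm_pscale.
Qed.

Lemma near_scale_gt0 : \forall h \near (0 : R)^', 0 < h + 1.
Proof.
near=> h; have : `|h| < 1 by near: h; exact: dnbhs0_lt.
by rewrite ltr_norml => /andP[]; lra.
Unshelve. all: by end_near. Qed.

(** [F ((h + 1) y) - F y = h F y] for small [h], so the difference quotient is constant. *)
Lemma norm_Euler y : y != 0 -> dotv y (grad F y) = F y.
Proof.
move=> y0; rewrite -derive_dotv; last exact: norm_differentiable.
apply: lim_near_cst => //; near=> h.
have h0 : h != 0 by near: h; exact: nbhs_dnbhs_neq.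
have h1 : 0 < h + 1 by near: h; exact: near_scale_gt0.
rewrite /= -{2}[y]scale1r -scalerDl norm_pscale ?ltW// mulrDl mul1r addrK.
by rewrite [_ *: _]mulrA mulVf// mul1r.
Unshelve. all: by end_near. Qed.

(** The partial derivatives of [F] are constant along the ray through [y]. *)
Lemma mul_hess_norm y : y != 0 -> y *m hess F y = 0.
Proof.
move=> y0; apply/rowP => j; rewrite !mxE.
transitivity ('D_y (partial j F) y).
  rewrite derive_dotv; last exact: partial_norm_differentiable.
  by apply: eq_bigr => i _; rewrite !mxE.
apply: lim_near_cst => //; near=> h.
have h1 : 0 < h + 1 by near: h; exact: near_scale_gt0.
rewrite /= -{2}[y]scale1r -scalerDl partial_norm_pscale//.
by rewrite subrr scaler0.
Unshelve. all: by end_near. Qed.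

Lemma hess_norm_sym y : y != 0 -> (hess F y)^T = hess F y.
Proof. exact: (hess_symmetric open_neq0 F_C2). Qed.

Lemma hess_norm_mul y : y != 0 -> hess F y *m y^T = 0.
Proof.
by move=> y0; rewrite -hess_norm_sym// -trmx_mul mul_hess_norm// trmx0.
Qed.

Lemma hess_half_sq y : y != 0 ->
  hess (half_sq F) y = F y *: hess F y + (grad F y)^T *m grad F y.
Proof.
move=> y0; apply/matrixP => i j; rewrite !mxE big_ord1 !mxE.
have dF z k : z != 0 -> derivable F z (delta_mx 0 k).
  by move=> z0; exact/diff_derivable/norm_differentiable.
have half z : z != 0 -> partial j (half_sq F) z = F z * partial j F z.
  move=> z0; rewrite /partial (_ : half_sq F = 2^-1 *: (F * F)); last first.
    by apply/funext => w; rewrite /half_sq expr2.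
  rewrite deriveZ ?deriveM //;
    [|exact: dF..|exact: derivableM (dF _ _ _) (dF _ _ _)].
  rewrite -[LHS]/(2^-1 * (_ * _ + _ * _)) -/(partial j F z).
  by move: (F z) (partial j F z) => a b; lra.
(* The formula [half] is available away from 0 only, hence the passage to functions equal near
   [y]. *)
transitivity ('D_(delta_mx 0 i) (F * partial j F) y).
  apply: near_eq_derive; apply: filterS (near_neq0 y0) => z; exact: half.
rewrite deriveM; first by rewrite [X in _ + X]mulrC.
- exact: dF.
- exact/diff_derivable/partial_norm_differentiable.
Qed.

End SmoothNorms.

(** * Curvatures of level sets *)

Section Hyperplanes.
Variables (R : realType) (n : nat).
Implicit Types (v w : 'rV[R]_n).

Lemma rank_kermx_tr w : w != 0 -> \rank (kermx w^T) = n.-1.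
Proof. by move=> w0; rewrite mxrank_ker mxrank_tr rank_rV w0 subn1. Qed.

Lemma basis_orth_exists w : w != 0 -> exists E, is_basis_orth w E.
Proof.
move=> w0; have : (row_base (kermx w^T) <= kermx w^T)%MS by rewrite eq_row_base.
move: (row_base_free (kermx w^T)); move: (row_base _).
rewrite rank_kermx_tr// => E Efree; rewrite sub_kermx => /eqP Ew.
by exists E.
Qed.

Lemma basis_orthZ (a : R) w E : a != 0 ->
  is_basis_orth (a *: w) E -> is_basis_orth w E.
Proof.
move=> a0 [Efree]; rewrite linearZ /= -scalemxAr => /eqP.
by rewrite scaler_eq0 (negPf a0) => /eqP.
Qed.

(** The rows of [M] lie in the kernel of [w^T], which by dimension is the row space of [E]. *)
Lemma factor_basis_orth m w E (M : 'M[R]_(m, n)) : w != 0 ->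
  is_basis_orth w E -> M *m w^T = 0 -> exists X, M = X *m E.
Proof.
move=> w0 [Efree Ew] Mw; apply/submxP.
have Ek : (E <= kermx w^T)%MS by rewrite sub_kermx Ew.
have /andP[_ kE] : (E == kermx w^T)%MS.
  by rewrite -(mxrank_leqif_eq Ek) rank_kermx_tr//; exact/eqP/eqP.
by apply: submx_trans kE; rewrite sub_kermx Mw.
Qed.

Lemma dotvE v w : v *m w^T = (dotv v w)%:M.
Proof.
apply/matrixP => i j; rewrite !ord1 !mxE mulr1n.
by apply: eq_bigr => l _; rewrite mxE.
Qed.

End Hyperplanes.

(** * The differential of the anisotropic normal and its eigenvalues *)

Section Differentials.
Variables (R : realType) (n : nat) (F u : 'rV[R]_n -> R).
Variables (Omega : set 'rV[R]_n) (t : R) (x : 'rV[R]_n).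
Hypotheses (F_norm : is_norm F) (F_C2 : Ck_on 2 [set xi | xi != 0] F).
Hypotheses (Omega_open : open Omega) (u_C2 : Ck_on 2 Omega u).
Hypothesis nondegenerate : forall y, level_set Omega u t y -> grad u y != 0.
Hypothesis x_level : level_set Omega u t x.

Let xi := grad u x.
Let xi0 : xi != 0. Proof. exact: nondegenerate. Qed.

Lemma enorm_gt0 (v : 'rV[R]_n) : v != 0 -> 0 < enorm v.
Proof. by move=> v0; rewrite sqrtr_gt0 dotv_gt0. Qed.

Lemma aniso_normal_differential :
  is_differential_on (level_set Omega u t) (aniso_normal F (level_normal u)) x
    (hess u x *m hess F xi).
Proof.
move=> c c0 cM /derivableP dc; set w := 'D_1 c 0 in dc *.
have [Ox _] := x_level.
have dgu : is_derive (0 : R) 1 (fun s => grad u (c s)) (w *m hess u (c 0)).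
  apply: is_derive_grad_curve => // j; rewrite c0.
  by case: u_C2 => _ /(_ j)[_ uC1]; exact: (C1_differentiable Omega_open uC1).
have dgF : is_derive (0 : R) 1 (fun s => grad F (grad u (c s)))
    (w *m hess u (c 0) *m hess F (grad u (c 0))).
  apply: (is_derive_grad_curve _ dgu) => j; rewrite c0.
  exact: (partial_norm_differentiable F_C2).
(* The normalization of [grad u] drops out only where [grad u] is non-zero, which holds while the
   curve is on the level set. *)
rewrite mulmxA /xi -c0; apply: near_eq_is_derive dgF.
apply: filterS cM => s /nondegenerate gs0 /=.
rewrite /aniso_normal /level_normal (grad_norm_pscale F_norm F_C2)//.
by rewrite invr_gt0 enorm_gt0.
Qed.

Lemma differential_tangent_unique (L L' : 'M[R]_n) g (w : 'rV[R]_n) :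
  is_differential_on (level_set Omega u t) g x L ->
  is_differential_on (level_set Omega u t) g x L' ->
  dotv w xi = 0 -> w *m L = w *m L'.
Proof.
move=> dL dL' wxi; have [Ox ux] := x_level.
have [c [c0 cM cw]] := level_curve Omega_open (Ck_onW u_C2) Ox xi0 wxi.
have cM' : \forall s \near (0 : R), level_set Omega u t (c s).
  by apply: filterS cM => s []; rewrite ux.
have [dc cw'] := cw.
have [_] := dL c c0 cM' dc; have [_] := dL' c c0 cM' dc.
by rewrite cw' => ->.
Qed.

Lemma differential_basis_orth (L L' : 'M[R]_n) g E :
  is_differential_on (level_set Omega u t) g x L ->
  is_differential_on (level_set Omega u t) g x L' ->
  is_basis_orth xi E -> E *m L = E *m L'.
Proof.
move=> dL dL' [_ Exi]; apply/row_matrixP => i; rewrite !row_mul.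
apply: (differential_tangent_unique dL dL').
have := congr1 (row i) Exi; rewrite row_mul dotvE row0 => /matrixP/(_ 0 0).
by rewrite !mxE mulr1n.
Qed.

Lemma basis_orth_level_normal E :
  is_basis_orth (level_normal u x) E -> is_basis_orth xi E.
Proof. by apply: basis_orthZ; rewrite invr_neq0// gt_eqF// enorm_gt0. Qed.

Lemma Svec_aniso_curvatures k (kappa : 'rV[R]_n.-1) :
  is_aniso_curvatures F (level_set Omega u t) (level_normal u) x kappa ->
  Svec k kappa = Smx k (hess F xi *m hess u x).
Proof.
move=> [L [E [A [dL /basis_orth_level_normal oE EL cA]]]].
have [Efree _] := oE.
have EL0 := differential_basis_orth dL aniso_normal_differential oE.
have [X LX] : exists X, hess u x *m hess F xi = X *m E.
  apply: (factor_basis_orth xi0 oE).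
  rewrite -mulmxA (hess_norm_mul F_norm F_C2 xi0); exact: mulmx0.
rewrite Smx_mulmxC LX; apply/esym/Smx_eigenvalues.
suff -> : E *m X = A by [].
(* [A E = E L = E X E], and [E] cancels on the right because its rows are free. *)
by apply: (row_free_inj Efree); rewrite -EL EL0 LX mulmxA.
Qed.

(** Subtracting a multiple of [xi] makes [v] orthogonal to [grad F xi]. This kills the rank-one term
    of the Hessian of [half_sq F], and does not change the form of [hess F xi], whose kernel
    contains [xi]. *)
Lemma hess_norm_pos (v : 'rV[R]_n) : pos_def (hess (half_sq F) xi) ->
  (forall a, v != a *: xi) -> 0 < (v *m hess F xi *m v^T) 0 0.
Proof.
move=> pos vxi; have F0 := norm_gt0 F_norm xi0.
pose v' := v - (dotv v (grad F xi) / F xi) *: xi.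
have v'0 : v' != 0 by rewrite subr_eq0.
have v'a : v' *m (grad F xi)^T = 0.
  rewrite dotvE /v' -scaleNr dotvD dotvZ (norm_Euler F_norm F_C2 xi0).
  by rewrite mulNr divfK ?gt_eqF// subrr raddf0.
have := pos _ v'0; rewrite (hess_half_sq F_C2 xi0) mulmxDr mulmxDl !mulmxA v'a.
rewrite !mul0mx addr0 -scalemxAr -scalemxAl mxE pmulr_rgt0//.
rewrite /v' mulmxBl -scalemxAl (mul_hess_norm F_norm F_C2 xi0) scaler0 subr0.
rewrite linearB linearZ /= mulmxBr -scalemxAr -(mulmxA v _ xi^T).
by rewrite (hess_norm_mul F_norm F_C2 xi0) mulmx0 scaler0 subr0.
Qed.

Lemma aniso_curvatures_exist : pos_def (hess (half_sq F) xi) ->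
  exists kappa : 'rV[R]_n.-1,
    is_aniso_curvatures F (level_set Omega u t) (level_normal u) x kappa.
Proof.
move=> pos; have [Ox _] := x_level.
have nu0 : level_normal u x != 0.
  by rewrite scaler_eq0 negb_or invr_neq0 ?gt_eqF ?enorm_gt0.
have [E oEnu] := basis_orth_exists nu0; have oE := basis_orth_level_normal oEnu.
have [Efree Exi] := oE.
have [P EP] : exists P, E *m P = 1%:M by exists (pinvmx E); exact: mulmxVp.
set H := hess F xi; have HT : H^T = H by exact: (hess_norm_sym F_C2).
have HPE : H *m P *m E = H.
  have [X HX] : exists X, H = X *m E.
    by apply: (factor_basis_orth xi0 oE); exact: (hess_norm_mul F_norm F_C2).
  by rewrite HX -(mulmxA X) EP mulmx1.
have EPH : E^T *m P^T *m H = H.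
  by have := congr1 trmx HPE; rewrite !trmx_mul HT mulmxA.
(* [K] is the form [H] read in the basis: [E^T K E = H], hence [E U H = (E U E^T) K E] with [U] the
   Hessian of [u], and [S K] is the matrix of the differential. *)
pose K := P^T *m H *m P.
have EKE : E^T *m K *m E = H.
  by rewrite /K !mulmxA EPH HPE.
have KT : K^T = K by rewrite /K !trmx_mul trmxK HT mulmxA.
pose S := E *m hess u x *m E^T.
have ST : S^T = S.
  by rewrite /S !trmx_mul trmxK (hess_symmetric Omega_open u_C2 Ox) mulmxA.
have Kpos : pos_def K.
  move=> y y0; have -> : y *m K *m y^T = y *m P^T *m H *m (y *m P^T)^T.
    by rewrite trmx_mul trmxK /K !mulmxA.
  (* If [y P^T] were a multiple of [xi], multiplying by [E^T] would give [y = 0], as [E] annihilates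
     [xi]. *)
  apply: hess_norm_pos => // a; apply: contra_neq y0 => yP.
  have -> : y = y *m P^T *m E^T by rewrite -mulmxA -trmx_mul EP trmx1 mulmx1.
  by rewrite yP -scalemxAl -[xi]trmxK -trmx_mul Exi trmx0 scaler0.
have [kappa cA] := char_poly_mul_posdef_split ST KT Kpos.
exists kappa; exists (hess u x *m H), E, (S *m K); split.
- exact: aniso_normal_differential.
- exact: oEnu.
- by rewrite -[in LHS]EKE /S !mulmxA.
- exact: cA.
Qed.

Lemma sum_dSmx_aniso_hess k :
  \sum_i \sum_j dSmx k.+1 (aniso_hess F u x) i j * xi 0 j * grad F xi 0 i =
  F xi ^+ k.+1 * Smx k (hess F xi *m hess u x).
Proof.
have -> : aniso_hess F u x = F xi *: (hess F xi *m hess u x) +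
    (grad F xi)^T *m (grad F xi *m hess u x).
  rewrite mulmxA scalemxAl -mulmxDl -(hess_half_sq F_C2 xi0).
  by apply/matrixP => i j; rewrite !mxE.
apply: sum_dSmx_eigenvector.
  by rewrite mulmxA (mul_hess_norm F_norm F_C2 xi0) mul0mx.
by rewrite dotvE (norm_Euler F_norm F_C2).
Qed.

End Differentials.

(** The existence of real curvatures is part of the conclusion, so that the identities for every
    such [kappa] are not vacuous. *)
Theorem theorem2p5 (R : realType) (n : nat)
    (F : 'rV[R]_n -> R) (Omega : set 'rV[R]_n) (u : 'rV[R]_n -> R)
    (t : R) (k : nat)
    (F_norm : strongly_convex_norm F)
    (F_C3 : Ck_on 3 [set xi | xi != 0] F)
    (Omega_open : open Omega) (Omega_connected : connected Omega)
    (Omega_bounded : bounded_set Omega)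
    (u_cont : {within closure Omega, continuous u})
    (u_C2 : Ck_on 2 Omega u)
    (nondegenerate : forall x, level_set Omega u t x -> grad u x != 0)
    (k_range : (1 <= k <= n)%N)
    (x : 'rV[R]_n) (x_level : level_set Omega u t x) :
  (exists kappa : 'rV[R]_n.-1,
     is_aniso_curvatures F (level_set Omega u t) (level_normal u) x kappa) /\
  forall kappa : 'rV[R]_n.-1,
    is_aniso_curvatures F (level_set Omega u t) (level_normal u) x kappa ->
    Svec k kappa =
      Smx k (\matrix_(i, j) \sum_l hess F (grad u x) i l * hess u x l j) /\
    Smx k (\matrix_(i, j) \sum_l hess F (grad u x) i l * hess u x l j) =
      (F (grad u x) ^+ k.+1)^-1 *
      \sum_i \sum_j dSmx k.+1 (aniso_hess F u x) i j
                    * grad u x 0 j * grad F (grad u x) 0 i.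
Proof.
have [Fn Fpos] := F_norm; have F_C2 := Ck_onW F_C3.
have xi0 := nondegenerate x x_level.
have -> : \matrix_(i, j) \sum_l hess F (grad u x) i l * hess u x l j =
    hess F (grad u x) *m hess u x.
  by apply/matrixP => i j; rewrite !mxE.
split.
  exact: (aniso_curvatures_exist Fn F_C2 Omega_open u_C2 nondegenerate x_level
    (Fpos _ xi0)).
move=> kappa cur; split.
  exact: (Svec_aniso_curvatures Fn F_C2 Omega_open u_C2 nondegenerate x_level).
rewrite (sum_dSmx_aniso_hess Fn F_C2 nondegenerate x_level) mulKf//.
by rewrite expf_neq0// gt_eqF// norm_gt0.
Qed.
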